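(* The greedy algorithm described below finds an optimal solution of the local heating problem in time $\mathcal{O}(T^2)$.
   Context: Time is discretized into intervals $\mathcal{T}=\{1,\dots,T\}$. The local heating problem (in reformulated form) is: minimize $\sum_{t\in\mathcal{T}} P_t x_t$ subject to $A_t \le \sum_{i=1}^t x_i \le B_t$ for all $t\in\mathcal{T}$ and $x_t\in\{0,1\}$, where $P_t$ is the (possibly negative) price of running the converter in interval $t$. The integer sequences $(A_t)_t$ and $(B_t)_t$ (with $t=0,\dots,T$) each satisfy $Z_0=0$ and $Z_{t-1}\le Z_t\le Z_{t-1}+1$ for all $t\in\mathcal{T}$, and $A_t\le B_t$ for all $t\in\mathcal{T}$ (which is equivalent to feasibility). The greedy algorithm starts with $x_t:=0$ for all $t$ and processes the intervals $t^*\in\mathcal{T}$ in order of increasing price $P_{t^*}$. If $A_{t^*-1}<B_{t^*}$ and ($A_{t^*-1}<A_T$ or $P_{t^*}<0$), it sets $x_{t^*}:=1$ and updates the bounds as follows: with $t_A=\max\{t\in\mathcal{T}: A_t=A_{t^*-1}\}+1$ and $t_B=\min\{t\in\mathcal{T}: B_t=B_{t^*}\}$, replace $A_t$ by $A_t-1$ for all $t\ge t_A$ and $B_t$ by $B_t-1$ for all $t\ge t_B$ (leaving the values for smaller $t$ unchanged). *)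

(* Defs.v *)
(* Mathematical Components world. *)
From HB Require Import structures.
From mathcomp Require Import all_boot all_order all_algebra.

Set Implicit Arguments.
Unset Strict Implicit.
Unset Printing Implicit Defensive.

Import Order.TTheory GRing.Theory Num.Theory.
Local Open Scope ring_scope.

(* Sequences indexed by 0..T or 1..T are total functions on nat, whose values
   outside that range are irrelevant. *)

Definition bound_seq (T : nat) (Z : nat -> int) : Prop :=
  Z 0%N = 0 /\
  forall t : nat, (1 <= t <= T)%N -> Z t.-1 <= Z t <= Z t.-1 + 1.

Definition feasible (T : nat) (A B : nat -> int) (x : nat -> bool) : Prop :=
  forall t : nat, (1 <= t <= T)%N ->
    A t <= \sum_(1 <= i < t.+1) (x i : nat)%:Z <= B t.

Definition cost (R : realFieldType) (T : nat) (P : nat -> R)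
    (x : nat -> bool) : R :=
  \sum_(1 <= t < T.+1) P t * (x t)%:R.

Definition optimal (R : realFieldType) (T : nat) (P : nat -> R)
    (A B : nat -> int) (x : nat -> bool) : Prop :=
  feasible T A B x /\
  forall y : nat -> bool, feasible T A B y -> cost T P x <= cost T P y.

(* Ties between equal prices may be broken arbitrarily. *)
Definition price_order (R : realFieldType) (T : nat) (P : nat -> R)
    (s : seq nat) : Prop :=
  perm_eq s (iota 1 T) /\ sorted (fun t u => P t <= P u) s.

Record gstate := GState {
  gx : nat -> bool;
  gA : nat -> int;
  gB : nat -> int
}.

(* tA: the maximum over the empty set is 0, which is the intended value: it can
   only arise for t = 1 and A 1 = A 0 + 1, and then the bound A decreases from
   time 1 on.  tB: the set always contains t, so the default T is immaterial. *)
Definition greedy_step (R : realFieldType) (T : nat) (P : nat -> R)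
    (st : gstate) (t : nat) : gstate :=
  let: GState x A B := st in
  if (A t.-1 < B t) && ((A t.-1 < A T) || (P t < 0)) then
    let tA := (\max_(1 <= u < T.+1 | A u == A t.-1) u).+1 in
    let tB := (\big[minn/T]_(1 <= u < T.+1 | B u == B t) u)%N in
    GState (fun u => if u == t then true else x u)
           (fun u => if (tA <= u)%N then A u - 1 else A u)
           (fun u => if (tB <= u)%N then B u - 1 else B u)
  else st.

Definition greedy (R : realFieldType) (T : nat) (P : nat -> R)
    (A B : nat -> int) (s : seq nat) : nat -> bool :=
  gx (foldl (greedy_step T P) (GState (fun=> false) A B) s).

(* Running time is measured on a unit-cost random access machine, given by a
   small imperative language over nat-valued index variables, integer arrays
   and a read-only price array.  Variables and arrays are named by numbers.
   Arithmetic is limited to successor and predecessor, so that unit cost cannot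
   be abused through large numbers; prices can only be compared with each other
   and with 0. *)

Inductive nexp :=
| NConst of nat
| NVar of nat
| NSucc of nexp
| NPred of nexp.

Inductive iexp :=
| IConst of int
| IGet of nat & nexp
| IPred of iexp.

Inductive bexp :=
| BEqN of nexp & nexp
| BEqI of iexp & iexp
| BLtI of iexp & iexp
| BLtPrice of nexp & nexp
| BNegPrice of nexp
| BAnd of bexp & bexp
| BOr of bexp & bexp.

Inductive cmd :=
| Skip
| Set_ of nat & nexp
| Put of nat & nexp & iexp
| Seq of cmd & cmd
| If of bexp & cmd & cmd
| For of nat & nexp & nexp & cmd.

Record mem := Mem { vars : nat -> nat; arrs : nat -> nat -> int }.

Definition set_var (m : mem) (v n : nat) : mem :=
  Mem (fun w => if w == v then n else vars m w) (arrs m).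

Definition set_arr (m : mem) (a n : nat) (z : int) : mem :=
  Mem (vars m)
      (fun b k => if (b == a) && (k == n) then z else arrs m b k).

Fixpoint neval (m : mem) (e : nexp) : nat :=
  match e with
  | NConst n => n
  | NVar v => vars m v
  | NSucc e => (neval m e).+1
  | NPred e => (neval m e).-1
  end.

Fixpoint ieval (m : mem) (e : iexp) : int :=
  match e with
  | IConst z => z
  | IGet a e => arrs m a (neval m e)
  | IPred e => ieval m e - 1
  end.

Fixpoint beval (R : realFieldType) (P : nat -> R) (m : mem) (e : bexp) : bool :=
  match e with
  | BEqN e1 e2 => neval m e1 == neval m e2
  | BEqI e1 e2 => ieval m e1 == ieval m e2
  | BLtI e1 e2 => ieval m e1 < ieval m e2
  | BLtPrice e1 e2 => P (neval m e1) < P (neval m e2)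
  | BNegPrice e => P (neval m e) < 0
  | BAnd e1 e2 => beval P m e1 && beval P m e2
  | BOr e1 e2 => beval P m e1 || beval P m e2
  end.

(* Boolean connectives are charged for both arguments, so the number of steps
   needed to evaluate an expression is the number of its nodes. *)

Fixpoint nsteps (e : nexp) : nat :=
  match e with
  | NConst _ | NVar _ => 1
  | NSucc e | NPred e => (nsteps e).+1
  end.

Fixpoint isteps (e : iexp) : nat :=
  match e with
  | IConst _ => 1
  | IGet _ e => (nsteps e).+1
  | IPred e => (isteps e).+1
  end.

Fixpoint bsteps (e : bexp) : nat :=
  match e with
  | BEqN e1 e2 | BLtPrice e1 e2 => (nsteps e1 + nsteps e2).+1
  | BEqI e1 e2 | BLtI e1 e2 => (isteps e1 + isteps e2).+1
  | BNegPrice e => (nsteps e).+1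
  | BAnd e1 e2 | BOr e1 e2 => (bsteps e1 + bsteps e2).+1
  end.

(* Final memory and number of steps.  [For v lo hi c] evaluates both bounds once
   and runs c with v = lo, ..., hi (both included; not at all if hi < lo);
   every iteration costs one step on top of those of c. *)
Fixpoint exec (R : realFieldType) (P : nat -> R) (c : cmd) (m : mem) :
    mem * nat :=
  match c with
  | Skip => (m, 1%N)
  | Set_ v e => (set_var m v (neval m e), (nsteps e).+1)
  | Put a e z =>
      (set_arr m a (neval m e) (ieval m z), (nsteps e + isteps z).+1)
  | Seq c1 c2 =>
      let: (m1, k1) := exec P c1 m in
      let: (m2, k2) := exec P c2 m1 in
      (m2, (k1 + k2).+1)
  | If b c1 c2 =>
      let: (m', k) := exec P (if beval P m b then c1 else c2) m in
      (m', (bsteps b + k).+1)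
  | For v lo hi c =>
      foldl (fun (acc : mem * nat) (n : nat) =>
               let: (m', k) := exec P c (set_var acc.1 v n) in
               (m', (acc.2 + k).+1))
            (m, (nsteps lo + nsteps hi).+1)
            (index_iota (neval m lo) (neval m hi).+1)
  end.

Definition vT : nat := 0.
Definition vround : nat := 1.
Definition vt : nat := 2.
Definition vu : nat := 3.
Definition vtA : nat := 4.
Definition vtB : nat := 5.

Definition aA : nat := 0.
Definition aB : nat := 1.
Definition ax : nat := 2.
Definition adone : nat := 3.

Definition seqc (cs : seq cmd) : cmd := foldr Seq Skip cs.

Definition init_prog : cmd :=
  For vu (NConst 1) (NVar vT)
    (seqc [:: Put ax (NVar vu) (IConst 0);
              Put adone (NVar vu) (IConst 0)]).

(* Puts a cheapest unprocessed interval in vt. *)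
Definition select_prog : cmd :=
  seqc [::
    Set_ vt (NConst 0);
    For vu (NConst 1) (NVar vT)
      (If (BEqI (IGet adone (NVar vu)) (IConst 0))
         (If (BEqN (NVar vt) (NConst 0))
            (Set_ vt (NVar vu))
            (If (BLtPrice (NVar vu) (NVar vt))
               (Set_ vt (NVar vu))
               Skip))
         Skip);
    Put adone (NVar vt) (IConst 1)].

Definition step_prog : cmd :=
  If (BAnd (BLtI (IGet aA (NPred (NVar vt))) (IGet aB (NVar vt)))
           (BOr (BLtI (IGet aA (NPred (NVar vt))) (IGet aA (NVar vT)))
                (BNegPrice (NVar vt))))
    (seqc [::
       Put ax (NVar vt) (IConst 1);
       Set_ vtA (NConst 0);
       For vu (NConst 1) (NVar vT)
         (If (BEqI (IGet aA (NVar vu)) (IGet aA (NPred (NVar vt))))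
            (Set_ vtA (NVar vu))
            Skip);
       Set_ vtA (NSucc (NVar vtA));
       Set_ vtB (NConst 0);
       For vu (NConst 1) (NVar vT)
         (If (BAnd (BEqN (NVar vtB) (NConst 0))
                   (BEqI (IGet aB (NVar vu)) (IGet aB (NVar vt))))
            (Set_ vtB (NVar vu))
            Skip);
       For vu (NVar vtA) (NVar vT)
         (Put aA (NVar vu) (IPred (IGet aA (NVar vu))));
       For vu (NVar vtB) (NVar vT)
         (Put aB (NVar vu) (IPred (IGet aB (NVar vu))))])
    Skip.

Definition greedy_prog : cmd :=
  Seq init_prog
      (For vround (NConst 1) (NVar vT) (Seq select_prog step_prog)).

Definition input_mem (T : nat) (A B : nat -> int) : mem :=
  Mem (fun v => if v == vT then T else 0%N)
      (fun a k => if a == aA then A k else if a == aB then B k else 0).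

Definition run_greedy (R : realFieldType) (T : nat) (P : nat -> R)
    (A B : nat -> int) : mem * nat :=
  exec P greedy_prog (input_mem T A B).

Definition output (r : mem * nat) (t : nat) : int :=
  arrs r.1 ax t.

Definition steps (r : mem * nat) : nat := r.2.

(* Main.v *)
(* Greedy decisions are justified one at a time: any solution [z] for
   the current bounds can be exchanged, without raising the cost, for one that
   agrees with the decision about the current interval [t] and otherwise only
   uses intervals of [z], hence unprocessed ones, which are not cheaper than [t].
   After an acceptance, the bounds are shifted exactly so that removing [t] is a
   bijection from the solutions containing [t] onto the solutions for the new
   bounds that avoid [t].  The tightening of the lower bound on [t, tA) and of
   the upper bound on [tB, t) is harmless, as partial sums are monotone. *)

Require Import Defs.
From mathcomp Require Import all_boot all_order all_algebra.
From mathcomp Require Import zify ring lra.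

Import Order.TTheory GRing.Theory Num.Theory.
Local Open Scope ring_scope.

(** * Partial sums and single changes *)

Definition psum (z : nat -> bool) (u : nat) : int :=
  \sum_(1 <= i < u.+1) (z i : nat)%:Z.

Lemma psum0 (z : nat -> bool) : psum z 0 = 0.
Proof. by rewrite /psum big_geq. Qed.

Lemma psumS (z : nat -> bool) (u : nat) :
  psum z u.+1 = psum z u + (z u.+1 : nat)%:Z.
Proof. by rewrite /psum big_nat_recr. Qed.

Lemma psum_pred (z : nat -> bool) (t : nat) :
  (0 < t)%N -> psum z t = psum z t.-1 + (z t : nat)%:Z.
Proof. by case: t => // t _; rewrite psumS. Qed.

Lemma psum_mono (z : nat -> bool) (u v : nat) :
  (u <= v)%N -> psum z u <= psum z v.
Proof.
elim: v => [|v IH]; first by rewrite leqn0 => /eqP ->.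
rewrite leq_eqVlt => /orP[/eqP -> //|]; rewrite ltnS => /IH.
by rewrite psumS; lia.
Qed.

Definition upd (z : nat -> bool) (t : nat) (b : bool) : nat -> bool :=
  fun u => if u == t then b else z u.

Lemma psum_upd (z : nat -> bool) (t : nat) (b : bool) (u : nat) : (0 < t)%N ->
  psum (upd z t b) u =
  psum z u + (if (t <= u)%N then (b : nat)%:Z - (z t : nat)%:Z else 0).
Proof.
move=> t0; elim: u => [|u IH]; first by rewrite !psum0 leqNgt t0.
rewrite !psumS IH /upd [(t <= u.+1)%N]leq_eqVlt ltnS eq_sym.
by case: eqVneq => [->|_] /=; [rewrite ltnn|case: ifP]; lia.
Qed.

Lemma cost_upd (R : realFieldType) (T : nat) (P : nat -> R) (z : nat -> bool)
    (t : nat) (b : bool) : (1 <= t <= T)%N ->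
  cost T P (upd z t b) =
  cost T P z + (if b then P t else 0) - (if z t then P t else 0).
Proof.
move=> tT; rewrite /cost.
have tI : t \in index_iota 1 T.+1 by rewrite mem_index_iota.
rewrite !(bigD1_seq t tI (iota_uniq _ _)) /= {1}/upd eqxx.
under eq_bigr => i /negbTE it do rewrite /upd it.
by case: b; case: (z t) => /=; ring.
Qed.

(** This supplies the interval that an exchange moves to a later time. Up to [u], deleting it lowers
    only sums equal to [psum z u]. *)
Lemma psum_last (z : nat -> bool) (u : nat) : 0 < psum z u ->
  exists i, [/\ (1 <= i <= u)%N, z i &
    forall v, (i <= v <= u)%N -> psum z v = psum z u].
Proof.
elim: u => [|u IH]; first by rewrite psum0.
rewrite psumS; case: (boolP (z u.+1)) => zu.
  move=> _; exists u.+1; split=> //; first by rewrite leqnn.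
  by move=> v; rewrite -eqn_leq => /eqP <-; rewrite psumS zu.
rewrite addr0 => /IH[i [/andP[i1 iu] zi cst]]; exists i; split=> //.
  by rewrite i1 leqW.
move=> v /andP[iv]; rewrite leq_eqVlt => /orP[/eqP ->|].
  by rewrite psumS (negbTE zu) addr0.
by rewrite ltnS => vu; apply: cst; rewrite iv.
Qed.

(** Counterpart for an interval that is moved to an earlier time: before it, the sums that rise are
    all equal to [psum z u]. *)
Lemma psum_first (z : nat -> bool) (u w : nat) : (u <= w)%N ->
  psum z u < psum z w ->
  exists i, [/\ (u < i <= w)%N, z i &
    forall v, (u <= v < i)%N -> psum z v = psum z u].
Proof.
elim: w => [|w IH]; first by rewrite leqn0 => /eqP ->; rewrite ltxx.
rewrite leq_eqVlt => /orP[/eqP -> |]; first by rewrite ltxx.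
rewrite ltnS => uw lt; case: (ltP (psum z u) (psum z w)) => [/(IH uw)|le].
  move=> [i [/andP[ui iw] zi cst]]; exists i; split=> //.
  by rewrite ui leqW.
exists w.+1; split; first by rewrite ltnS uw leqnn.
- by move: lt; rewrite psumS; case: (z w.+1) => //; rewrite addr0 ltNge le.
- move=> v /andP[uv]; rewrite ltnS => vw.
  apply/eqP; rewrite eq_le (psum_mono z u v uv) andbT.
  exact: le_trans (psum_mono z v w vw) le.
Qed.

(** The invariant of the bounds under greedy steps. The start [l] is 0 for lower and 1 for upper
    bounds, since the search for [tB] begins at 1 and does not compare with [B 0]. *)
Definition mono_on (l T : nat) (Z : nat -> int) : Prop :=
  forall u v, (l <= u)%N -> (u <= v <= T)%N -> Z u <= Z v.

Lemma bound_seq_mono (T : nat) (Z : nat -> int) :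
  bound_seq T Z -> mono_on 0 T Z.
Proof.
move=> [_ stp] u v _; elim: v => [|v IH] /andP[].
  by rewrite leqn0 => /eqP ->.
rewrite leq_eqVlt => /orP[/eqP -> //|]; rewrite ltnS => uv vT.
have /andP[le _] := stp v.+1 vT.
by apply: le_trans (IH _) le; rewrite uv ltnW.
Qed.

(** Choosing the intervals in which [B] rises makes the partial sums follow [B] exactly. *)
Lemma bound_seq_feasible (T : nat) (A B : nat -> int) :
  bound_seq T B -> (forall t, (1 <= t <= T)%N -> A t <= B t) ->
  feasible T A B (fun t => (1 <= t <= T)%N && (B t.-1 < B t)).
Proof.
move=> [B0 stp] AB; set z := (fun t => _).
suff E t : (t <= T)%N -> psum z t = B t.
  by move=> t /[dup] /AB le /andP[_ /E]; rewrite -/(psum z t) => ->; rewrite le /=.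
elim: t => [|t IH] tT; first by rewrite psum0 B0.
rewrite psumS (IH (ltnW tT)) /z tT /=.
by have := stp t.+1 tT; case: ltP => /=; lia.
Qed.

(** * Last and first occurrence of a value of a bound *)

Lemma bigmax_natS (p : pred nat) (n : nat) : (0 < n)%N ->
  (\max_(1 <= u < n.+1 | p u) u =
   if p n then n else \max_(1 <= u < n | p u) u)%N.
Proof.
move=> n0; rewrite !(big_mkcond p) big_nat_recr //= -big_mkcond /=.
case: ifP => _; rewrite ?maxn0 //; apply/maxn_idPr/bigmax_leqP_seq => i.
by rewrite mem_index_iota => /andP[_ /ltnW].
Qed.

Lemma bigmax_natP (p : pred nat) (n : nat) :
  let m := (\max_(1 <= u < n.+1 | p u) u)%N in
  (m = 0%N \/ p m /\ (1 <= m <= n)%N) /\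
  forall v, (m < v <= n)%N -> ~~ p v.
Proof.
elim: n => [|n [IH1 IH2]] /=.
  by rewrite big_geq //; split=> [|v]; [left|rewrite leqn0; case: v].
rewrite bigmax_natS //; case: ifP => pn.
  by split=> [|v]; [right; rewrite leqnn|case: ltngtP].
split; first by case: IH1 => [->|[pm /andP[m1 mn]]]; [left|right; rewrite m1 leqW].
move=> v /andP[mv]; rewrite leq_eqVlt => /orP[/eqP ->|vn]; first by rewrite pn.
by apply: IH2; rewrite mv.
Qed.

Lemma bigmin_natP (p : pred nat) (n k : nat) : (1 <= k <= n)%N -> p k ->
  (forall u, (1 <= u < k)%N -> ~~ p u) ->
  (\big[minn/n]_(1 <= u < n.+1 | p u) u = k)%N.
Proof.
move=> /andP[k1 kn] pk below; apply/eqP; rewrite eqn_leq; apply/andP; split.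
  have: k \in index_iota 1 n.+1 by rewrite mem_index_iota k1.
  elim: (index_iota _ _) => // i r IH; rewrite inE big_cons.
  case/orP => [/eqP <-|/IH le]; first by rewrite pk geq_minl.
  by case: ifP => // _; apply: leq_trans (geq_minr _ _) le.
(* The default [n] is at least [k] as well, so the lower estimate survives it. *)
rewrite big_seq_cond; elim/big_ind: _ => // [x y kx ky|i].
  by rewrite leq_min kx.
rewrite mem_index_iota (leqNgt k) => /andP[/andP[i1 _] pi].
by apply/negP => ik; have := below i; rewrite i1 ik pi => /(_ isT).
Qed.

(* The maximum is 0 if its range is empty; then [t = 1], so the first
   conclusion holds in that case too. *)
Lemma last_levelP (T : nat) (A : nat -> int) (t : nat) : (1 <= t <= T)%N ->
  let m := (\max_(1 <= u < T.+1 | A u == A t.-1) u)%N in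
  [/\ A m = A t.-1, (t.-1 <= m <= T)%N &
      forall v, (m < v <= T)%N -> A v <> A t.-1].
Proof.
move=> tT m; have [m0 ub] := bigmax_natP (fun u => A u == A t.-1) T.
rewrite -/m in m0 ub.
have tm : (t.-1 <= m)%N.
  rewrite leqNgt; apply/negP => mt; suff: ~~ (A t.-1 == A t.-1) by rewrite eqxx.
  by apply: ub; lia.
have mT : (m <= T)%N by lia.
split; [|by rewrite tm|by move=> v /ub /eqP].
by case: m0 => [m0|[/eqP]//]; move: tm; rewrite m0 leqn0 => /eqP ->.
Qed.

Lemma first_levelP (T : nat) (B : nat -> int) (t : nat) : (1 <= t <= T)%N ->
  let m := (\big[minn/T]_(1 <= u < T.+1 | B u == B t) u)%N in
  [/\ B m = B t, (1 <= m <= t)%N &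
      forall v, (1 <= v < m)%N -> B v <> B t].
Proof.
move=> /andP[t1 tT] /=.
have ex : exists k, (0 < k)%N && (B k == B t) by exists t; rewrite t1 eqxx.
case: (ex_minnP ex) => k /andP[k1 /eqP Bk] kmin.
have kt : (k <= t)%N by apply: kmin; rewrite t1 eqxx.
have below v : (1 <= v < k)%N -> B v <> B t.
  move=> /andP[v1 vk] /eqP Bv; move: (kmin v); rewrite v1 Bv => /(_ isT).
  by rewrite leqNgt vk.
have -> : (\big[minn/T]_(1 <= u < T.+1 | B u == B t) u)%N = k.
  apply: bigmin_natP => [||u /below /eqP //]; first by rewrite k1 (leq_trans kt).
  by rewrite Bk.
by rewrite k1.
Qed.

(** * The bounds after an acceptance *)

Definition shift (Z : nat -> int) (a : nat) : nat -> int :=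
  fun u => if (a <= u)%N then Z u - 1 else Z u.

(** Only pairs on both sides of the cut matter: beyond the last index at level [A t.-1] the values
    are strictly larger, and the integer gap absorbs the decrement. *)
Lemma mono_shift_lower (T : nat) (A : nat -> int) (t : nat) :
  (1 <= t <= T)%N -> mono_on 0 T A ->
  mono_on 0 T (shift A (\max_(1 <= u < T.+1 | A u == A t.-1) u).+1).
Proof.
move=> tT mA u v _ uv; have [] := last_levelP T A t tT.
set m := (\max_(_ <= _ < _ | _) _)%N => Am mT above.
have le1 := mA u v isT uv; rewrite /shift.
case: ifP => mu; case: ifP => mv; try lia.
have := mA u m isT; have := mA m v isT; have := above v; lia.
Qed.

(** Dually, values before the first index at level [B t] are strictly below that level, so lowering
    the rest by 1 does not undercut them. *)
Lemma mono_shift_upper (T : nat) (B : nat -> int) (t : nat) :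
  (1 <= t <= T)%N -> mono_on 1 T B ->
  mono_on 1 T (shift B (\big[minn/T]_(1 <= u < T.+1 | B u == B t) u)%N).
Proof.
move=> tT mB u v u1 uv; have [] := first_levelP T B t tT.
set m := (\big[minn/T]_(_ <= _ < _ | _) _)%N => Bm mt below.
have le1 := mB u v u1 uv; rewrite /shift.
case: ifP => mu; case: ifP => mv; try lia.
have := mB u m u1; have := mB m v; have := below u; lia.
Qed.

(** Two ranges need an argument. On [t, tA) the sum drops but the lower bound does not, and [A u <=
    A t.-1 <= psum z t.-1 = psum z t - 1 <= psum z u - 1]. On [tB, t) only the upper bound drops,
    and [psum z u <= psum z t - 1 <= B t - 1 <= B u - 1]. *)
Lemma feasible_shift (T : nat) (A B : nat -> int) (z : nat -> bool) (t : nat) :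
  (1 <= t <= T)%N -> A 0%N = 0 -> mono_on 0 T A -> mono_on 1 T B ->
  feasible T A B z -> z t ->
  feasible T (shift A (\max_(1 <= u < T.+1 | A u == A t.-1) u).+1)
    (shift B (\big[minn/T]_(1 <= u < T.+1 | B u == B t) u)%N) (upd z t false).
Proof.
move=> tT A0 mA mB fz zt u uT; rewrite -/(psum _ u) psum_upd; last by lia.
have [] := first_levelP T B t tT; have [] := last_levelP T A t tT.
rewrite /shift.
set a := (\max_(_ <= _ < _ | _) _)%N => Aa aT _.
set b := (\big[minn/T]_(_ <= _ < _ | _) _)%N => Bb bt _.
have fu := fz u uT; have ft := fz t tT; rewrite -/(psum z u) in fu.
rewrite -/(psum z t) (psum_pred z t) ?zt in ft; last by lia.
have ft1 : A t.-1 <= psum z t.-1.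
  (* Feasibility says nothing about time 0, so [t = 1] relies on [A 0 = 0]. *)
  have [t1|t1] := posnP t.-1; first by rewrite t1 A0 psum0.
  by have /andP[] := fz t.-1 ltac:(lia).
have := mA u a isT; have := mB b u ltac:(lia).
have := psum_mono z t u; have := psum_mono z u t.-1.
rewrite (psum_pred z t) ?zt; last by lia.
case: ifP => au; case: ifP => bu; case: ifP => tu; lia.
Qed.

(** Sums rise by 1 from [t] on; the lower bound rises only from [tA >= t], the upper bound already
    from [tB <= t]. *)
Lemma feasible_unshift (T : nat) (A B : nat -> int) (z : nat -> bool) (t : nat) :
  (1 <= t <= T)%N ->
  feasible T (shift A (\max_(1 <= u < T.+1 | A u == A t.-1) u).+1)
    (shift B (\big[minn/T]_(1 <= u < T.+1 | B u == B t) u)%N) z ->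
  ~~ z t -> feasible T A B (upd z t true).
Proof.
move=> tT fz zt u uT; rewrite -/(psum _ u) psum_upd; last by lia.
have [_ bt _] := first_levelP T B t tT; have [_ aT _] := last_levelP T A t tT.
move: (fz u uT) aT bt; rewrite -/(psum z u) /shift.
set a := (\max_(_ <= _ < _ | _) _)%N.
set b := (\big[minn/T]_(_ <= _ < _ | _) _)%N.
by case: ifP => au; case: ifP => bu; case: ifP => tu; lia.
Qed.

(** * Exchange arguments *)

Definition accepts (R : realFieldType) (T : nat) (P : nat -> R)
    (A B : nat -> int) (t : nat) : bool :=
  (A t.-1 < B t) && ((A t.-1 < A T) || (P t < 0)).

(** If [z] uses [t], then [A t.-1 < psum z t <= B t], so the rejection is due to [A T <= A t.-1] and
    [0 <= P t]. Dropping [t] does not raise the cost, and the sums from [t] on still reach [A t.-1],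
    hence [A T]. *)
Lemma reject_exchange (R : realFieldType) (T : nat) (P : nat -> R)
    (A B : nat -> int) (t : nat) (z : nat -> bool) :
  (1 <= t <= T)%N -> A 0%N = 0 -> mono_on 0 T A ->
  feasible T A B z -> ~~ accepts R T P A B t ->
  feasible T A B (upd z t false) /\ cost T P (upd z t false) <= cost T P z.
Proof.
move=> tT A0 mA fz; rewrite /accepts => rej.
have [zt|zt] := boolP (z t); last first.
  have E : z =1 upd z t false.
    by move=> i; rewrite /upd; case: eqVneq => // ->; rewrite (negbTE zt).
  split.
    by move=> u uT; have := fz u uT; under eq_bigr => i _ do rewrite E.
  by rewrite le_eqVlt; apply/orP; left; apply/eqP; apply: eq_bigr => i _; rewrite E.
have ft := fz t tT; rewrite -/(psum z t) (psum_pred z t) ?zt /= in ft; last by lia.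
have ft1 : A t.-1 <= psum z t.-1.
  have [t1|t1] := posnP t.-1; first by rewrite t1 A0 psum0.
  by have /andP[] := fz t.-1 ltac:(lia).
have [Pt AT] : 0 <= P t /\ A T <= A t.-1.
  move: rej; rewrite negb_and negb_or -(leNgt _ (P t)).
  by case/orP => [AB|/andP[AT Pt]]; [exfalso; lia|split=> //; lia].
split; last by rewrite cost_upd // zt; move: Pt; lra.
move=> u uT; rewrite -/(psum _ u) psum_upd; last by lia.
have := fz u uT; rewrite -/(psum z u) zt.
have := psum_mono z t u; rewrite (psum_pred z t) ?zt; last by lia.
have := mA u T isT; case: ifP => tu; lia.
Qed.

(* If the partial sum of [z] up to t-1 exceeds A t-1, the last chosen interval
   before [t] can be moved to [t]; otherwise the first chosen one after [t] can,
   and if there is none then A T <= A t-1, so [P t < 0] and [t] can be added. *)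
Lemma accept_exchange (R : realFieldType) (T : nat) (P : nat -> R)
    (A B : nat -> int) (t : nat) (z : nat -> bool) :
  (1 <= t <= T)%N -> A 0%N = 0 -> mono_on 0 T A -> mono_on 1 T B ->
  feasible T A B z -> accepts R T P A B t -> ~~ z t ->
  (forall i, z i -> P t <= P i) ->
  exists w, [/\ feasible T A B w, cost T P w <= cost T P z, w t &
    forall i, w i -> i = t \/ z i].
Proof.
move=> tT A0 mA mB fz /andP[AB acc] zt cheap.
have move_to i : (1 <= i <= T)%N -> z i ->
  feasible T A B (upd (upd z i false) t true) -> exists w,
    [/\ feasible T A B w, cost T P w <= cost T P z, w t &
      forall i, w i -> i = t \/ z i].
  move=> iT zi fw; exists (upd (upd z i false) t true); split=> //.
  - have it : t != i by apply: contraNneq zt => ->.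
    rewrite !cost_upd // {1}/upd (negbTE it) zi (negbTE zt).
    by move: (cheap i zi); lra.
  - by rewrite /upd eqxx.
  - by move=> j; rewrite /upd; case: eqVneq => [|_]; [left|case: ifP; right].
have psumw i u : (1 <= i)%N -> z i -> psum (upd (upd z i false) t true) u =
    psum z u - (i <= u)%N%:Z + (t <= u)%N%:Z.
  move=> i1 zi; have it : t != i by apply: contraNneq zt => ->.
  rewrite !psum_upd //; last by lia.
  by rewrite {1}/upd (negbTE it) zi (negbTE zt); case: ifP; case: ifP; lia.
have pt : psum z t = psum z t.-1.
  by rewrite psum_pred ?(negbTE zt) ?addr0 //; lia.
have ft := fz t tT; rewrite -/(psum z t) in ft.
(* As the lower bound is nonnegative, a sum above it is positive and has a last chosen interval. *)
have A0t := mA 0%N t.-1 isT ltac:(lia).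
have ft1 : A t.-1 <= psum z t.-1.
  have [t1|t1] := posnP t.-1; first by rewrite t1 A0 psum0.
  by have /andP[] := fz t.-1 ltac:(lia).
have [lt|le] := ltP (A t.-1) (psum z t.-1).
  have [i [it zi cst]] := psum_last z t.-1 ltac:(lia).
  apply: (move_to i) => // [|u uT]; first by lia.
  rewrite -/(psum _ u) psumw //; last by lia.
  (* Only sums on [i, t) drop; there they equal [psum z t.-1 > A t.-1 >= A u]. *)
  have := fz u uT; rewrite -/(psum z u); have := cst u.
  by have := mA u t.-1 isT; lia.
have [ltT|leT] := ltP (psum z t) (psum z T).
  have [i [it zi cst]] := psum_first z t T ltac:(lia) ltT.
  apply: (move_to i) => // [|u uT]; first by lia.
  rewrite -/(psum _ u) psumw //; last by lia.
  (* Only sums on [t, i) rise; there they equal [psum z t <= A t.-1 < B t <= B u]. *)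
  have := fz u uT; rewrite -/(psum z u); have := cst u.
  by have := mB t u; lia.
have /andP[AT _] := fz T ltac:(lia); rewrite -/(psum z T) in AT.
have Pt : P t < 0 by case/orP: acc => //; lia.
exists (upd z t true); split.
- move=> u uT; rewrite -/(psum _ u) psum_upd ?(negbTE zt); last by lia.
  (* From [t] on, sums are at most [psum z T <= psum z t <= A t.-1 < B t <= B u]. *)
  have := fz u uT; rewrite -/(psum z u); have := psum_mono z u T.
  by have := mB t u; case: ifP; lia.
- by rewrite cost_upd // (negbTE zt); move: Pt; lra.
- by rewrite /upd eqxx.
- by move=> j; rewrite /upd; case: eqVneq => [|_]; [left|right].
Qed.

(** * Optimality by induction over the processing order *)

Lemma greedy_stepE (R : realFieldType) (T : nat) (P : nat -> R)
    (x : nat -> bool) (A B : nat -> int) (t : nat) :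
  greedy_step T P (GState x A B) t =
  if accepts R T P A B t then
    GState (upd x t true)
      (shift A (\max_(1 <= u < T.+1 | A u == A t.-1) u).+1)
      (shift B (\big[minn/T]_(1 <= u < T.+1 | B u == B t) u)%N)
  else GState x A B.
Proof. by []. Qed.

(** Induction on the unprocessed intervals [s], for arbitrary current bounds. The witness [w]
    collects the intervals still to be accepted and is kept apart from those already in [x]. As [z]
    lives on the sorted list [s], its head is a cheapest interval compared with all those of [z]. *)
Lemma greedy_from (R : realFieldType) (T : nat) (P : nat -> R) (s : seq nat)
    (x : nat -> bool) (A B : nat -> int) (z : nat -> bool) :
  uniq s -> sorted (fun t u => P t <= P u) s ->
  (forall i, i \in s -> (1 <= i <= T)%N) ->
  A 0%N = 0 -> mono_on 0 T A -> mono_on 1 T B ->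
  feasible T A B z -> (forall i, z i -> i \in s) ->
  exists w, [/\ feasible T A B w, cost T P w <= cost T P z,
    forall i, w i -> i \in s &
    forall i, gx (foldl (greedy_step T P) (GState x A B) s) i = x i || w i].
Proof.
elim: s x A B z => [|t s IH] x A B z.
  move=> _ _ _ _ _ _ fz zs; exists z; split=> // i.
  by case zi: (z i); rewrite /= ?orbF //; have := zs i zi.
rewrite cons_uniq [sorted _ _]/= => /andP[ts us] srt sT A0 mA mB fz zs.
rewrite -[foldl _ _ (t :: s)]/(foldl _ (greedy_step _ _ _ t) s).
have tT : (1 <= t <= T)%N by apply: sT; rewrite inE eqxx.
have cheap i : z i -> P t <= P i.
  move=> /zs; rewrite inE => /orP[/eqP -> //|is_].
  have le_tr : transitive (fun t u => P t <= P u).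
    by move=> b a c /=; apply: le_trans.
  by move: (order_path_min le_tr srt) => /allP /(_ _ is_).
have srt' := path_sorted srt.
have sT' i : i \in s -> (1 <= i <= T)%N.
  by move=> is_; apply: sT; rewrite inE is_ orbT.
rewrite greedy_stepE; case: ifP => acc; last first.
  have [fz' cz'] := reject_exchange R T P A B t z tT A0 mA fz (negbT acc).
  have [|w [fw cw ws xw]] := IH x A B _ us srt' sT' A0 mA mB fz'.
    by move=> i; rewrite /upd; case: eqVneq => // it /zs; rewrite inE (negbTE it).
  exists w; split=> //; first exact: le_trans cw cz'.
  by move=> i /ws; rewrite inE orbC => ->.
have [z1 [fz1 cz1 z1t z1s]] : exists w, [/\ feasible T A B w,
    cost T P w <= cost T P z, w t & forall i, w i -> i \in t :: s].
  have [zt|zt] := boolP (z t); first by exists z; split.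
  have [w [fw cw wt ws]] := accept_exchange R T P A B t z tT A0 mA mB fz acc zt cheap.
  exists w; split=> // i /ws [->|/zs //]; exact: mem_head.
have [||w [fw cw ws xw]] := IH (upd x t true) _ _ _ us srt' sT' _
  (mono_shift_lower T A t tT mA) (mono_shift_upper T B t tT mB)
  (feasible_shift T A B z1 t tT A0 mA mB fz1 z1t).
- by rewrite /shift.
- by move=> i; rewrite /upd; case: eqVneq => // it /z1s; rewrite inE (negbTE it).
(* [w] lives on the tail, which excludes [t] because the order has no repetitions; so [t] can be put
   back. *)
have wt : ~~ w t by apply: contra ts; exact: ws.
exists (upd w t true); split.
- exact: feasible_unshift.
- apply: le_trans cz1; move: cw; rewrite !cost_upd // (negbTE wt) z1t; lra.
- by move=> i; rewrite /upd inE; case: eqVneq => //= _ /ws.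
- by move=> i; rewrite xw /upd; case: eqVneq => // _; rewrite orbT.
Qed.

Lemma greedy_optimal (R : realFieldType) (T : nat) (P : nat -> R)
    (A B : nat -> int) (s : seq nat) :
  bound_seq T A -> bound_seq T B ->
  (forall t, (1 <= t <= T)%N -> A t <= B t) ->
  price_order T P s -> optimal T P A B (greedy T P A B s).
Proof.
move=> bA bB AB [ps srt].
have sE i : (i \in s) = (1 <= i <= T)%N.
  by rewrite (perm_mem ps) mem_iota add1n ltnS.
have us : uniq s by rewrite (perm_uniq ps) iota_uniq.
have mB : mono_on 1 T B by move=> u v _; exact: bound_seq_mono bB u v isT.
have main y : feasible T A B y ->
  feasible T A B (greedy T P A B s) /\
  cost T P (greedy T P A B s) <= cost T P y.
  (* A competitor may choose times outside 1..T, where neither feasibility nor cost sees them;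
     cutting these off gives it support in [s]. *)
  move=> fy; pose z i := (1 <= i <= T)%N && y i.
  have zy u : (u <= T)%N -> forall i, (1 <= i < u.+1)%N -> z i = y i.
    by move=> uT i /andP[i1 iu]; rewrite /z i1 (leq_trans _ uT).
  have fz : feasible T A B z.
    move=> u uT; have := fy u uT.
    by rewrite (eq_big_nat _ _ (F2 := fun i => (z i : nat)%:Z)) // => i iu;
       rewrite (zy u) //; lia.
  have cz : cost T P z = cost T P y.
    by apply: eq_big_nat => i iT; rewrite (zy T).
  have [||w [fw cw _ gw]] := greedy_from R T P s (fun=> false) A B z us srt _
    (proj1 bA) (bound_seq_mono T A bA) mB fz.
  - by move=> i; rewrite sE.
  - by move=> i /andP[]; rewrite sE.
  have gE : greedy T P A B s =1 w by move=> i; rewrite /greedy gw.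
  split; first by move=> u uT; under eq_bigr => i _ do rewrite gE; exact: fw.
  by rewrite -cz; apply: le_trans cw; rewrite /cost; under eq_bigr => i _ do rewrite gE.
split=> [|y /main[] //].
(* Feasibility of the greedy solution comes from comparing it with any one feasible competitor. *)
by have [] := main _ (bound_seq_feasible T A B bB AB).
Qed.

(** * Running time *)

Definition is_vT (e : nexp) : bool := if e is NVar v then v == vT else false.

(* In such commands every loop makes at most T.+1 iterations. *)
Fixpoint keeps_vT (c : cmd) : bool :=
  match c with
  | Skip | Put _ _ _ => true
  | Set_ v _ => v != vT
  | Seq c1 c2 | If _ c1 c2 => keeps_vT c1 && keeps_vT c2
  | For v _ hi c => [&& v != vT, is_vT hi & keeps_vT c]
  end.

(** A bound read off the syntax: adding the branches of a conditional bounds their maximum, and a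
    loop starting at 0 and ending at [T] has [T.+1] rounds. *)
Fixpoint max_steps (T : nat) (c : cmd) : nat :=
  match c with
  | Skip => 1
  | Set_ _ e => (nsteps e).+1
  | Put _ e z => (nsteps e + isteps z).+1
  | Seq c1 c2 => (max_steps T c1 + max_steps T c2).+1
  | If b c1 c2 => (bsteps b + (max_steps T c1 + max_steps T c2)).+1
  | For _ lo hi c => (nsteps lo + nsteps hi).+1 + T.+1 * (max_steps T c).+1
  end.

Lemma max_stepsP (R : realFieldType) (P : nat -> R) (T : nat) (c : cmd)
    (m : Defs.mem) :
  keeps_vT c -> vars m vT = T ->
  vars (exec P c m).1 vT = T /\ ((exec P c m).2 <= max_steps T c)%N.
Proof.
elim: c m => [|v e|a e z|c1 IH1 c2 IH2|b c1 IH1 c2 IH2|v lo hi c IH] m /=.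
- by [].
- by move=> /negbTE vN mT; rewrite eq_sym vN.
- by [].
- move=> /andP[k1 k2] mT; have [] := IH1 m k1 mT.
  case: (exec P c1 m) => m1 n1 /= mT1 le1; have [] := IH2 m1 k2 mT1.
  by case: (exec P c2 m1) => m2 n2 /= mT2 le2; split=> //; lia.
- move=> /andP[k1 k2] mT; have [] := IH1 m k1 mT; have [] := IH2 m k2 mT.
  by case: (beval P m b); case: (exec P c1 m); case: (exec P c2 m) => /=;
    move=> ? ? ? ? ? ? ? ?; split=> //; lia.
- case/and3P=> /negbTE vN; case: hi => // w /eqP -> kc mT /=; rewrite mT.
  set r := index_iota _ _; set a := (_, _).
  have sr : (size r <= T.+1)%N by rewrite size_iota; lia.
  set f := fun acc n => _.
  suff [fT fs] : vars (foldl f a r).1 vT = T /\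
      ((foldl f a r).2 <= a.2 + size r * (max_steps T c).+1)%N.
    by split=> //; apply: leq_trans fs _; rewrite leq_add ?leq_mul.
  have: vars a.1 vT = T by [].
  elim: r a {sr} => [|n r IHr] a aT /=; first by split=> //; lia.
  have [] := IH (set_var a.1 v n) kc; first by rewrite /= eq_sym vN.
  rewrite {-3}/f; case: (exec P c _) => m1 n1 /= m1T le1.
  by have [] := IHr (m1, (a.2 + n1).+1) m1T => /=; split=> //; lia.
Qed.

(** Loops are nested at most two deep, so the syntactic bound is a quadratic polynomial in [T]; for
    [T >= 1] a generous constant absorbs its lower terms. *)
Lemma run_greedy_steps (R : realFieldType) (T : nat) (P : nat -> R)
    (A B : nat -> int) : (0 < T)%N ->
  (steps (run_greedy T P A B) <= 1000 * T ^ 2)%N.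
Proof.
move=> T0; have [//|_ le] := max_stepsP R P T greedy_prog (input_mem T A B) isT.
apply: leq_trans le _; rewrite /=; nia.
Qed.

(** * The program computes the greedy solution *)

Definition run (R : realFieldType) (P : nat -> R) (c : cmd) (m : Defs.mem) :
  Defs.mem := (exec P c m).1.

Lemma run_Seq (R : realFieldType) (P : nat -> R) (c1 c2 : cmd) (m : Defs.mem) :
  run R P (Seq c1 c2) m = run R P c2 (run R P c1 m).
Proof. by rewrite /run /=; case: (exec P c1 m) => m1 n1 /=; case: (exec P c2 m1). Qed.

Lemma run_If (R : realFieldType) (P : nat -> R) (b : bexp) (c1 c2 : cmd)
    (m : Defs.mem) :
  run R P (If b c1 c2) m = run R P (if beval P m b then c1 else c2) m.
Proof. by rewrite /run /=; case: (beval P m b); case: (exec P _ m). Qed.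

Lemma run_For (R : realFieldType) (P : nat -> R) (v : nat) (lo hi : nexp)
    (c : cmd) (m : Defs.mem) :
  run R P (For v lo hi c) m =
  foldl (fun m' n => run R P c (set_var m' v n)) m
    (index_iota (neval m lo) (neval m hi).+1).
Proof.
rewrite /run /=; move: (index_iota _ _) (nsteps lo + _).+1 => r.
elim: r m => //= n r IH m k.
by case: (exec P c (set_var m v n)) => m' k' /=; rewrite IH.
Qed.

(** The invariant is indexed by the next counter value. The first hypothesis lets an empty loop end
    at the upper limit plus 1 too. *)
Lemma run_For_inv (R : realFieldType) (P : nat -> R) (I : nat -> Defs.mem -> Prop)
    (v : nat) (lo hi : nexp) (c : cmd) (m : Defs.mem) :
  (neval m lo <= (neval m hi).+1)%N ->
  I (neval m lo) m ->
  (forall n m', (neval m lo <= n <= neval m hi)%N -> I n m' ->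
     I n.+1 (run R P c (set_var m' v n))) ->
  I (neval m hi).+1 (run R P (For v lo hi c) m).
Proof.
rewrite run_For; move: (neval m lo) (neval m hi) => a b le I0 IS.
set f := fun _ _ => _.
suff H k : (a + k <= b.+1)%N -> I (a + k)%N (foldl f m (iota a k)).
  by have := H (b.+1 - a)%N; rewrite subnKC // => /(_ (leqnn _)).
elim: k => [|k IH] le'; first by rewrite addn0.
by rewrite -[in iota _ _]addn1 iotaD foldl_cat addnS /=; apply: IS; [lia|apply: IH; lia].
Qed.

(** Each hit overwrites [vtA], so the last one remains; the initial 0 agrees with the empty
    maximum. *)
Lemma run_last_level (R : realFieldType) (P : nat -> R) (T : nat) (m : Defs.mem) :
  vars m vT = T -> vars m vtA = 0%N ->
  let m' := run R P
    (For vu (NConst 1) (NVar vT)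
       (If (BEqI (IGet aA (NVar vu)) (IGet aA (NPred (NVar vt))))
          (Set_ vtA (NVar vu)) Skip)) m in
  [/\ arrs m' = arrs m,
      vars m' vtA =
        (\max_(1 <= u < T.+1 | arrs m aA u == arrs m aA (vars m vt).-1) u)%N &
      forall w, w != vu -> w != vtA -> vars m' w = vars m w].
Proof.
move=> mT m0; pose I n (m' : Defs.mem) := [/\ arrs m' = arrs m,
  vars m' vtA =
    (\max_(1 <= u < n | arrs m aA u == arrs m aA (vars m vt).-1) u)%N &
  forall w, w != vu -> w != vtA -> vars m' w = vars m w].
move=> m'; suff: I T.+1 m' by [].
rewrite /m' -{1}mT.
apply: (run_For_inv R P I) => //; first by split=> //; rewrite big_geq.
move=> n k /= nT [arr max frame].
have n0 : (0 < n)%N by lia.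
split.
- by rewrite run_If; case: ifP.
- rewrite run_If bigmax_natS // -arr /= frame //.
  by case: ifP => _ //; rewrite arr.
- by move=> w w1 w2; rewrite run_If -frame //; case: ifP => _;
    rewrite /= ?(negbTE w1) ?(negbTE w2).
Qed.

(** Here 0 in [vtB] means that no hit has occurred, which is unambiguous as indices start at 1.
    After the loop this case is excluded, since the current interval is itself a hit. *)
Lemma run_first_level (R : realFieldType) (P : nat -> R) (T : nat)
    (m : Defs.mem) :
  vars m vT = T -> (1 <= vars m vt <= T)%N -> vars m vtB = 0%N ->
  let m' := run R P
    (For vu (NConst 1) (NVar vT)
       (If (BAnd (BEqN (NVar vtB) (NConst 0))
                 (BEqI (IGet aB (NVar vu)) (IGet aB (NVar vt))))
          (Set_ vtB (NVar vu)) Skip)) m in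
  [/\ arrs m' = arrs m,
      vars m' vtB =
        (\big[minn/T]_(1 <= u < T.+1 | arrs m aB u == arrs m aB (vars m vt)) u)%N &
      forall w, w != vu -> w != vtB -> vars m' w = vars m w].
Proof.
move=> mT tT m0; pose p u := arrs m aB u == arrs m aB (vars m vt).
pose I n (m' : Defs.mem) := [/\ arrs m' = arrs m,
  (vars m' vtB = 0%N /\ forall u, (1 <= u < n)%N -> ~~ p u) \/
  [/\ (1 <= vars m' vtB < n)%N, p (vars m' vtB) &
      forall u, (1 <= u < vars m' vtB)%N -> ~~ p u] &
  forall w, w != vu -> w != vtB -> vars m' w = vars m w].
move=> m'; suff [arr first frame] : I T.+1 m'.
  split=> //; case: first => [[_ no]|[m1 pm below]].
    by move: (no (vars m vt)); rewrite ltnS tT /p eqxx => /(_ isT).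
  by symmetry; apply: bigmin_natP.
rewrite /m' -{1}mT.
apply: (run_For_inv R P I) => //; first by split=> //; left; split=> // -[].
move=> n k /= nT [arr first frame].
have pE : (arrs k aB n == arrs k aB (vars k vt)) = p n by rewrite /p arr frame.
split.
- by rewrite run_If; case: ifP.
- rewrite run_If /= pE; case: first => [[k0 no]|[k1 pk below]].
    rewrite k0 /=.
    case: ifP => /= pn; last first.
      left; split=> // u un; case: (ltngtP u n) => [un'|un'|->].
      - by apply: no; lia.
      - by lia.
      - by rewrite pn.
    by right; split=> //; lia.
  have -> /= : (vars k vtB == 0%N) = false by lia.
  by right; split=> //; lia.
- by move=> w w1 w2; rewrite run_If -frame //; case: ifP => _;
    rewrite /= ?(negbTE w1) ?(negbTE w2).
Qed.

(** The start may be [T.+1]: this is [tA] when the level of [A] lasts until [T], and the loop is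
    then empty. *)
Lemma run_decrement (R : realFieldType) (P : nat -> R) (T a w : nat)
    (m : Defs.mem) : vars m vT = T -> (vars m w <= T.+1)%N ->
  let m' := run R P
    (For vu (NVar w) (NVar vT)
       (Put a (NVar vu) (IPred (IGet a (NVar vu))))) m in
  (forall v, v != vu -> vars m' v = vars m v) /\
  forall b k, arrs m' b k =
    if (b == a) && (vars m w <= k <= T)%N then arrs m b k - 1 else arrs m b k.
Proof.
move=> mT wT; pose I n (m' : Defs.mem) :=
  (forall v, v != vu -> vars m' v = vars m v) /\
  forall b k, arrs m' b k =
    if (b == a) && (vars m w <= k < n)%N then arrs m b k - 1 else arrs m b k.
move=> m'; suff [frame arr] : I T.+1 m' by [].
rewrite /m' -{1}mT.
apply: (run_For_inv R P I); rewrite /= ?mT //.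
  by split=> // b k; rewrite [(_ <= _ < _)%N](_ : _ = false) ?andbF //; lia.
move=> n k nT [frame arr]; split=> [v vN|b j].
  by rewrite /= (negbTE vN) frame.
rewrite /= !arr eqxx /=.
case: eqVneq => [->|] //=; case: (eqVneq j n) => [->|jn] //=.
  rewrite ltnn andbF; case: ifP; lia.
by rewrite ltnS [(j <= n)%N]leq_eqVlt (negbTE jn).
Qed.

(** Agreement is limited to the relevant indices, because [greedy_step] also shifts the bounds
    beyond [T], where the loops do not reach. *)
Definition represents (T : nat) (m : Defs.mem) (st : gstate) : Prop :=
  [/\ vars m vT = T,
      forall u, (u <= T)%N -> arrs m aA u = gA st u,
      forall u, (u <= T)%N -> arrs m aB u = gB st u &
      forall u, (1 <= u <= T)%N -> arrs m ax u = (gx st u : nat)%:Z].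

Lemma run_step (R : realFieldType) (P : nat -> R) (T : nat) (m : Defs.mem)
    (st : gstate) : represents T m st -> (1 <= vars m vt <= T)%N ->
  represents T (run R P step_prog m) (greedy_step T P st (vars m vt)) /\
  arrs (run R P step_prog m) adone =1 arrs m adone.
Proof.
case: st => x A B [mT mA mB mx] tT; move Et: (vars m vt) tT => t tT.
rewrite /= in mA mB mx; rewrite greedy_stepE /step_prog run_If.
have -> : beval P m (BAnd (BLtI (IGet aA (NPred (NVar vt))) (IGet aB (NVar vt)))
           (BOr (BLtI (IGet aA (NPred (NVar vt))) (IGet aA (NVar vT)))
                (BNegPrice (NVar vt)))) = accepts R T P A B t.
  by rewrite /= mT Et !mA ?mB //; lia.
case: ifP => _; last by [].
rewrite /seqc /foldr !run_Seq.
have -> : run R P (Put ax (NVar vt) (IConst 1)) m = set_arr m ax t 1.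
  by rewrite -Et.
set m1 := run R P (Set_ vtA (NConst 0)) _.
have arr1 : arrs m1 = arrs (set_arr m ax t 1) by [].
have vars1 w : vars m1 w = if w == vtA then 0%N else vars m w by [].
clearbody m1.
have T1 : vars m1 vT = T by rewrite vars1.
have t1 : vars m1 vt = t by rewrite vars1.
have [] := run_last_level R P T m1 T1 (vars1 _); rewrite t1.
set m2 := run R P _ m1 => arr2 tA frame2; clearbody m2.
(* This memory also includes the increment of [vtA] from the last index of the level to [tA]. *)
set m4 := run R P (Set_ vtB (NConst 0)) _.
have arr4 : arrs m4 = arrs (set_arr m ax t 1) by rewrite -arr1 -arr2.
have vars4 w : w != vu -> vars m4 w =
    if w == vtB then 0%N else if w == vtA then (vars m2 vtA).+1 else vars m w.
  rewrite /m4 /= => wN; case: eqVneq => // _; case: eqVneq => // wA.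
  by rewrite frame2 // vars1 (negbTE wA).
clearbody m4.
have [|||] := run_first_level R P T m4; rewrite ?vars4 //= ?Et //.
set m5 := run R P _ m4 => arr5 tB frame5; clearbody m5.
have levA : (\max_(1 <= u < T.+1 | arrs m1 aA u == arrs m1 aA t.-1) u
    = \max_(1 <= u < T.+1 | A u == A t.-1) u)%N.
  rewrite big_nat_cond [RHS]big_nat_cond; apply: eq_bigl => u.
  by case: (boolP (_ <= _ < _)%N) => //= uT; rewrite arr1 /= !mA //; lia.
have levB : (\big[minn/T]_(1 <= u < T.+1 | arrs m4 aB u == arrs m4 aB t) u
    = \big[minn/T]_(1 <= u < T.+1 | B u == B t) u)%N.
  rewrite big_nat_cond [RHS]big_nat_cond; apply: eq_bigl => u.
  by case: (boolP (_ <= _ < _)%N) => //= uT; rewrite arr4 /= !mB //; lia.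
have [_ bt _] := first_levelP T B t tT; have [_ aT _] := last_levelP T A t tT.
rewrite levA in tA; rewrite levB in tB.
have tA5 : vars m5 vtA = (\max_(1 <= u < T.+1 | A u == A t.-1) u).+1.
  by rewrite frame5 // vars4 //= tA.
have T5 : vars m5 vT = T by rewrite frame5 // vars4.
have [|frame6 arr6] := run_decrement R P T aA vtA m5 T5; first by rewrite tA5; lia.
set m6 := run R P _ m5 in frame6 arr6 *; clearbody m6.
have T6 : vars m6 vT = T by rewrite frame6.
have tB6 : vars m6 vtB = (\big[minn/T]_(1 <= u < T.+1 | B u == B t) u)%N.
  by rewrite frame6.
have [|frame7 arr7] := run_decrement R P T aB vtB m6 T6; first by rewrite tB6; lia.
set m7 := run R P _ m6 in frame7 arr7 *; clearbody m7.
rewrite [run R P Skip m7]/=.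
have arrm5 : arrs m5 = arrs (set_arr m ax t 1) by rewrite arr5 arr4.
split; last by move=> u; rewrite arr7 arr6 arrm5.
split=> /=.
- by rewrite frame7.
- by move=> u uT; rewrite arr7 arr6 arrm5 tA5 uT !andbT /= mA.
- by move=> u uT; rewrite arr7 arr6 arrm5 tB6 uT !andbT /= mB.
- move=> u uT; rewrite arr7 arr6 arrm5 /= /upd.
  by case: (eqVneq u t) => //= _; rewrite mx.
Qed.

(** The cells of [ax] and [adone] are 0 in the input already, so all arrays stay pointwise
    unchanged. *)
Lemma run_init (R : realFieldType) (P : nat -> R) (T : nat) (A B : nat -> int) :
  let m := run R P init_prog (input_mem T A B) in
  represents T m (GState (fun=> false) A B) /\
  forall u, arrs m adone u = 0.
Proof.
move=> m; suff [mT arr] : vars m vT = T /\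
    forall b k, arrs m b k = arrs (input_mem T A B) b k.
  by split=> [|u]; [split=> [//|u uT|u uT|u uT]|]; rewrite ?arr.
pose I (n : nat) (m' : Defs.mem) := vars m' vT = T /\
  forall b k, arrs m' b k = arrs (input_mem T A B) b k.
apply: (run_For_inv R P I) => // n k nT [kT arr].
rewrite /seqc /foldr !run_Seq; split=> //= b j; rewrite !arr /=.
by case: eqVneq => [->|_] /=; [case: ifP|case: eqVneq => [->|//] /=; case: ifP].
Qed.

(** A linear search for a minimum outside the processed list [s], with 0 in [vt] until a candidate
    is met; the existence hypothesis rules out 0 at the end. *)
Lemma run_select (R : realFieldType) (P : nat -> R) (T : nat) (m : Defs.mem)
    (s : seq nat) :
  vars m vT = T ->
  (forall u, (1 <= u <= T)%N -> arrs m adone u = (u \in s : nat)%:Z) ->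
  (exists2 u, (1 <= u <= T)%N & u \notin s) ->
  let m' := run R P select_prog m in
  [/\ vars m' vT = T, (1 <= vars m' vt <= T)%N, vars m' vt \notin s,
      forall u, (1 <= u <= T)%N -> u \notin s -> P (vars m' vt) <= P u &
      forall b k, arrs m' b k =
        if (b == adone) && (k == vars m' vt) then 1 else arrs m b k].
Proof.
move=> mT done [u0 u0T u0s]; rewrite /select_prog /seqc /foldr !run_Seq.
set m1 := run R P (Set_ vt (NConst 0)) m.
pose I n (m' : Defs.mem) := [/\ vars m' vT = T, arrs m' = arrs m &
  (vars m' vt = 0%N /\ forall u, (1 <= u < n)%N -> u \in s) \/
  [/\ (1 <= vars m' vt < n)%N, vars m' vt \notin s &
      forall u, (1 <= u < n)%N -> u \notin s -> P (vars m' vt) <= P u]].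
set m2 := run R P _ m1.
suff [T2 arr2 sel] : I T.+1 m2.
  case: sel => [[_ no]|[t2 ts cheap]].
    by move: u0s; rewrite no // ltnS.
  by split=> //= b k; rewrite arr2.
rewrite /m2 -{1}mT; apply: (run_For_inv R P I) => //=.
  by split=> //; left; split=> // -[].
move=> n k nT [kT arr sel]; rewrite mT in nT.
have below u : (1 <= u < n.+1)%N -> u = n \/ (1 <= u < n)%N.
  by move=> un; case: (eqVneq u n) => [|un']; [left|right; lia].
have dn : (arrs k adone n == 0) = (n \notin s).
  by rewrite arr done //; case: (n \in s).
rewrite run_If /= dn; case: ifP => /= ns; last first.
  split=> //=; case: sel => [[k0 no]|[k1 ks cheap]]; [left|right].
    by split=> // u /below [->|/no //]; apply: negbFE.
  by split=> //; [lia|move=> u /below [->|/cheap //]; rewrite ns].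
rewrite run_If /=; case: sel => [[k0 no]|[k1 ks cheap]].
  rewrite k0 /=; split=> //=; right; split=> //=; first by lia.
  by move=> u /below [->//|/no ->].
have -> /= : (vars k vt == 0%N) = false by lia.
rewrite run_If /=; case: (ltP (P n) (P (vars k vt))) => le; split=> //=; right.
  split=> //=; first by lia.
  move=> u /below [-> //|un us]; exact: le_trans (ltW le) (cheap u un us).
by split=> //=; [lia|move=> u /below [->|/cheap]].
Qed.

(** The order [s] is read off the run, as the list of selected intervals. The invariant that no
    processed interval is dearer than an unprocessed one lets each selection be appended; [pairwise]
    makes this extension at the end direct. *)
Lemma run_greedy_output (R : realFieldType) (T : nat) (P : nat -> R)
    (A B : nat -> int) :
  exists2 s, price_order T P s &
    forall t, (1 <= t <= T)%N ->
      output (run_greedy T P A B) t = (greedy T P A B s t : nat)%:Z.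
Proof.
rewrite /output /run_greedy -/(run R P greedy_prog (input_mem T A B)).
set st0 := GState (fun=> false) A B.
pose I n (m : Defs.mem) := exists s : seq nat,
  [/\ (size s).+1 = n, uniq s, {subset s <= iota 1 T},
      pairwise (fun t u => P t <= P u) s &
      [/\ forall i j, i \in s -> (1 <= j <= T)%N -> j \notin s -> P i <= P j,
          represents T m (foldl (greedy_step T P) st0 s) &
          forall u, (1 <= u <= T)%N -> arrs m adone u = (u \in s : nat)%:Z]].
suff [s [sT us sI srt [_ [_ _ _ out] _]]] :
    I T.+1 (run R P greedy_prog (input_mem T A B)).
  exists s; last exact: out.
  split; last exact: pairwise_sorted.
  apply: (uniq_perm us (iota_uniq _ _)).
  (* After [T] rounds, [T] distinct members of 1..T must be all of them. *)
  have le : (size (iota 1 T) <= size s)%N by rewrite size_iota; lia.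
  by case: (uniq_min_size us sI le).
have [rep0 done0] := run_init R P T A B.
rewrite /greedy_prog run_Seq.
set m0 := run R P init_prog _ in rep0 done0 *.
have T0 : vars m0 vT = T by case: rep0.
rewrite -{1}T0.
apply: (run_For_inv R P I vround (NConst 1) (NVar vT)) => //=.
  by exists [::]; split=> //; split=> // u _; rewrite done0.
rewrite T0 => n m nT [s [sn us sI srt [cheap rep done]]].
rewrite run_Seq; set m1 := set_var m vround n.
(* Fewer than [T] intervals are processed before this round, so one is left. *)
have [u uT us'] : exists2 u, (1 <= u <= T)%N & u \notin s.
  have [/allP sub|/allPn [u uI un]] := boolP (all (mem s) (iota 1 T)).
    have le : (size (iota 1 T) <= size s)%N := uniq_leq_size (iota_uniq 1 T) sub.
    by move: le; rewrite size_iota; lia.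
  by exists u => //; move: uI; rewrite mem_iota; lia.
have rep1 : represents T m1 (foldl (greedy_step T P) st0 s).
  by case: rep => rT rA rB rx; split.
have T1 : vars m1 vT = T by case: rep1.
have [|T2 t2 t2s min2 arr2] := run_select R P T m1 s T1 done; first by exists u.
set m2 := run R P select_prog m1 in T2 t2 t2s min2 arr2 *; clearbody m2.
have rep2 : represents T m2 (foldl (greedy_step T P) st0 s).
  by case: rep1 => rT rA rB rx; split=> // v vT; rewrite arr2 /= ?rA ?rB ?rx.
have [rep3 done3] := run_step R P T m2 _ rep2 t2.
exists (rcons s (vars m2 vt)); split.
- by rewrite size_rcons sn.
- by rewrite rcons_uniq t2s.
- by move=> i; rewrite mem_rcons inE => /orP[/eqP ->|/sI //]; rewrite mem_iota; lia.
- rewrite pairwise_rcons srt andbT; apply/allP => i is_; exact: cheap.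
- split.
  + move=> i j; rewrite !mem_rcons !inE negb_or => /orP[/eqP ->|is_] jT /andP[_ js].
      exact: min2.
    exact: cheap.
  + by rewrite foldl_rcons.
  + move=> v vT; rewrite done3 arr2 mem_rcons inE /=.
    by case: (v == _) => //=; exact: done.
Qed.

(** The middle clause links the other two: the program whose steps are counted outputs the greedy
    solution for some price order, and every such solution is optimal. *)
Theorem theorem1 (R : realFieldType) :
  exists C : nat,
    forall (T : nat) (P : nat -> R) (A B : nat -> int),
      (0 < T)%N ->
      bound_seq T A -> bound_seq T B ->
      (forall t : nat, (1 <= t <= T)%N -> A t <= B t) ->
      [/\ forall s : seq nat, price_order T P s ->
            optimal T P A B (greedy T P A B s),
          exists2 s : seq nat, price_order T P s &
            forall t : nat, (1 <= t <= T)%N ->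
              output (run_greedy T P A B) t = (greedy T P A B s t : nat)%:Z
        & (steps (run_greedy T P A B) <= C * T ^ 2)%N].
Proof.
exists 1000%N => T P A B T0 bA bB AB; split.
- by move=> s; exact: greedy_optimal.
- exact: run_greedy_output.
- exact: run_greedy_steps.
Qed.
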